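(* On regular input, there does not exist an online algorithm for $1|jrp,s=1,p_j=1,r_j|F_{\max}+c_\mathcal{Q}$ with competitive ratio better than $\frac43$; that is, for every $c<\frac43$ no online algorithm is $c$-competitive on regular inputs.
   Context: Problem $1|jrp,s=1,p_j=1,r_j|F_{\max}+c_\mathcal{Q}$: jobs with processing time $1$ and nonnegative integer release dates $r_j$ must be processed non-preemptively on a single machine (at most one job at a time). There is a single resource, required by every job; each replenishment of it costs $K:=K_0+K_1\ge0$ (part of the instance). A solution consists of start times $S_j$ (completion times $C_j=S_j+1$) and replenishment times $t_1<\dots<t_q$; it is feasible if no two jobs overlap and for each job $j$ some replenishment time lies in $[r_j,S_j]$. Its cost is $\max_j(C_j-r_j)+qK$. A regular input consists of jobs $1,\dots,n$ with $r_j=j$ for each $j$; the release dates are thus known in advance, but the number $n$ of jobs is unknown to the online algorithm. Online setting: a job becomes known at its release date, and replenishment and scheduling decisions cannot be revoked. An online algorithm is $c$-competitive (on regular input) if on every regular instance its cost is at most $c$ times the optimal offline cost. *)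

(* Defs.v *)
From HB Require Import structures.
From mathcomp Require Import all_boot all_order all_algebra.
From mathcomp Require Import all_classical all_reals.

Set Implicit Arguments.
Unset Strict Implicit.
Unset Printing Implicit Defensive.

Import Order.TTheory GRing.Theory Num.Theory.

Local Open Scope classical_set_scope.
Local Open Scope ring_scope.

(* The jobs are 1, ..., njobs; values of [release] at other indices are
   meaningless and never used.  [repl_cost] is K = K_0 + K_1. *)
Record instance (R : realType) := Instance {
  njobs : nat;
  release : nat -> nat;
  repl_cost : R
}.

Definition job (R : realType) (I : instance R) (j : nat) : bool :=
  (1 <= j <= njobs I)%N.

(* [start] matters only at the jobs of the instance. *)
Record solution (R : realType) := Solution {
  start : nat -> R;
  repls : seq R
}.

Definition completion (R : realType) (s : solution R) (j : nat) : R :=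
  start s j + 1.

Definition feasible (R : realType) (I : instance R) (s : solution R) : Prop :=
  [/\ sorted <%R (repls s),
      forall j k, job I j -> job I k -> j <> k ->
        completion s j <= start s k \/ completion s k <= start s j
    & forall j, job I j ->
        exists2 t, t \in repls s & (release I j)%:R <= t <= start s j].

(* The default value 0 of the maximum is harmless: flow times of feasible
   solutions are at least 1. *)
Definition max_flow_time (R : realType) (I : instance R) (s : solution R) : R :=
  \big[Num.max/0]_(1 <= j < (njobs I).+1) (completion s j - (release I j)%:R).

Definition cost (R : realType) (I : instance R) (s : solution R) : R :=
  max_flow_time I s + (size (repls s))%:R * repl_cost I.

Definition opt_cost (R : realType) (I : instance R) : R :=
  inf [set cost I s | s in [set s | feasible I s]].

Definition regular (R : realType) : set (instance R) :=
  [set I | [/\ (1 <= njobs I)%N, 0 <= repl_cost I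
             & forall j, job I j -> release I j = j]].

(* What is known at time t: the cost K and the jobs released at or before t. *)
Definition same_information (R : realType) (t : R) (I I' : instance R) : Prop :=
  repl_cost I = repl_cost I' /\
  forall j r : nat, r%:R <= t ->
    (job I j /\ release I j = r) <-> (job I' j /\ release I' j = r).

(* The irrevocable decisions taken up to time t: the replenishments at times at
   most t, and the pairs (j, u) such that job j is started at time u <= t. *)
Definition same_decisions (R : realType) (t : R) (I I' : instance R)
    (s s' : solution R) : Prop :=
  [seq u <- repls s | u <= t] = [seq u <- repls s' | u <= t] /\
  forall j (u : R), u <= t ->
    (job I j /\ start s j = u) <-> (job I' j /\ start s' j = u).

(* A deterministic online algorithm for the inputs in C: its decisions up to any
   time t depend only on the information available at time t. *)
Definition online_algorithm (R : realType) (C : set (instance R))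
    (A : instance R -> solution R) : Prop :=
  (forall I, C I -> feasible I (A I)) /\
  forall I I' (t : R), C I -> C I' ->
    same_information t I I' -> same_decisions t I I' (A I) (A I').

Definition competitive (R : realType) (C : set (instance R)) (c : R)
    (A : instance R -> solution R) : Prop :=
  forall I, C I -> cost I (A I) <= c * opt_cost I.

(* Main.v *)
(** Let [S] be the time at which the algorithm starts job 1 on a long input, and
    let [m] be the integer part of [S].  Until time [S] the algorithm cannot
    tell this input from the one with [m + 1] jobs.  On the latter it therefore
    pays for a replenishment by time [S] and for another one for job [m + 1],
    that is, at least [m + 2 K].  Averaging the one- and the two-replenishment
    schedules shows that the optimum is at most [3 / 4 * (m + 2 K) + 1], so the
    ratio tends to [4 / 3] as [K] grows.  If instead job 1 is not started before
    [8 K], then stopping the input after [8 K] jobs costs the algorithm at least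
    [9 K], against an optimum of at most [6 K]. *)
Require Import Defs.
From HB Require Import structures.
From mathcomp Require Import all_boot all_order all_algebra.
From mathcomp Require Import all_classical all_reals.
From mathcomp Require Import zify lra.

Set Implicit Arguments.
Unset Strict Implicit.
Unset Printing Implicit Defensive.

Import Order.TTheory GRing.Theory Num.Theory.

Local Open Scope classical_set_scope.
Local Open Scope ring_scope.

Section Instances.
Variables (R : realType) (I : instance R).
Implicit Types s : solution R.

Lemma flow_time_le_max s j : job I j ->
  completion s j - (release I j)%:R <= max_flow_time I s.
Proof.
move=> /andP[j1 jn]; rewrite /max_flow_time.
apply: (le_bigmax_seq _ j (fun=> true)
          (fun i => completion s i - (release I i)%:R)) => //.
by rewrite mem_index_iota j1 ltnS.
Qed.

Lemma max_flow_time_ge0 s : 0 <= max_flow_time I s.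
Proof. exact: bigmax_ge_id. Qed.

Lemma feasible_has_repl s : (1 <= njobs I)%N -> feasible I s ->
  (1 <= size (repls s))%N.
Proof.
move=> n1 [_ _ /(_ 1%N)]; rewrite /job n1 => /(_ isT)[t].
by case: (repls s).
Qed.

(** At least one replenishment must be paid for. This supplies both the lower bound that [inf] in
    [opt_cost] requires and a positive lower bound on the optimum when K is positive. *)
Lemma repl_cost_le_cost s : (1 <= njobs I)%N -> 0 <= repl_cost I ->
  feasible I s -> repl_cost I <= cost I s.
Proof.
move=> n1 K0 /(feasible_has_repl n1) q1.
rewrite /cost -[leLHS]add0r lerD ?max_flow_time_ge0//.
by rewrite ler_peMl// ler1n.
Qed.

Lemma opt_cost_le s : (1 <= njobs I)%N -> 0 <= repl_cost I ->
  feasible I s -> opt_cost I <= cost I s.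
Proof.
move=> n1 K0 fs; apply: ge_inf; last by exists s.
by exists (repl_cost I) => _ [s' fs' <-]; exact: repl_cost_le_cost.
Qed.

Lemma repl_cost_le_opt s : (1 <= njobs I)%N -> 0 <= repl_cost I ->
  feasible I s -> repl_cost I <= opt_cost I.
Proof.
move=> n1 K0 fs; apply: lb_le_inf; first by exists (cost I s), s.
by move=> _ [s' fs' <-]; exact: repl_cost_le_cost.
Qed.

End Instances.

Section RegularInput.
Variable R : realType.
Implicit Types (n h : nat) (K : R).

Definition regular_instance K n : instance R := Instance n id K.

Lemma regular_instanceP K n : (1 <= n)%N -> 0 <= K ->
  regular (regular_instance K n).
Proof. by []. Qed.

(** Back-to-back processing in release order from time [h]: on a regular input every flow time
    equals [h]. *)
Definition delayed h (ts : seq R) : solution R :=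
  Solution (fun j => (h + j.-1)%:R) ts.

Lemma delayed_cost_le K n h ts :
  cost (regular_instance K n) (delayed h ts) <= h%:R + (size ts)%:R * K.
Proof.
rewrite /cost lerD2r /max_flow_time big_seq.
apply: bigmax_le => // j; rewrite mem_index_iota => /andP[j1 _].
rewrite /completion /= lerBlDr natr1 -natrD ler_nat; lia.
Qed.

Lemma delayed_feasible K n h ts : sorted <%R ts ->
  (forall j, (1 <= j <= n)%N ->
     exists2 t, t \in ts & j%:R <= t <= (h + j.-1)%:R) ->
  feasible (regular_instance K n) (delayed h ts).
Proof.
move=> sts hts; split=> // j k; rewrite /job /completion /= => hj hk jk.
rewrite !natr1 !ler_nat.
have [jk'|jk'] := leqP j k; [left|right]; lia.
Qed.

Definition single n := delayed n [:: n%:R].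
(** Rounding up matters: the first job after the first batch starts at [2 * uphalf n], no earlier
    than the second replenishment at [n]. *)
Definition double n := delayed (uphalf n) [:: (uphalf n)%:R; n%:R].

Lemma single_feasible K n : feasible (regular_instance K n) (single n).
Proof.
apply: delayed_feasible => // j hj; exists n%:R; first by rewrite mem_seq1.
by rewrite !ler_nat; lia.
Qed.

Lemma double_feasible K n : (2 <= n)%N ->
  feasible (regular_instance K n) (double n).
Proof.
move=> n2; apply: delayed_feasible => /=; first by rewrite andbT ltr_nat; lia.
move=> j hj; have [jh|jh] := leqP j (uphalf n).
  by exists (uphalf n)%:R; rewrite ?mem_head// !ler_nat; lia.
by exists n%:R; rewrite ?inE ?eqxx ?orbT// !ler_nat; lia.
Qed.

Section OptBounds.
Variables (K : R) (n : nat).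
Hypotheses (K0 : 0 <= K) (n1 : (1 <= n)%N).

Lemma opt_regular_ge : K <= opt_cost (regular_instance K n).
Proof. exact: (repl_cost_le_opt _ _ (single_feasible K n)). Qed.

Lemma opt_regular_le_single : opt_cost (regular_instance K n) <= n%:R + K.
Proof.
have /= := opt_cost_le _ _ (single_feasible K n).
move=> /(_ n1 K0) /le_trans; apply.
by rewrite (le_trans (delayed_cost_le _ _ _ _))// mul1r.
Qed.

Lemma opt_regular_le_double : (2 <= n)%N ->
  opt_cost (regular_instance K n) <= (uphalf n)%:R + 2 * K.
Proof.
move=> n2; have /= := opt_cost_le _ _ (double_feasible K n2).
by move=> /(_ n1 K0) /le_trans; apply; exact: delayed_cost_le.
Qed.

End OptBounds.

Lemma same_information_regular K (t : R) n n' :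
  t < n.+1%:R -> t < n'.+1%:R ->
  same_information t (regular_instance K n) (regular_instance K n').
Proof.
move=> tn tn'; split=> // j r rt; rewrite /job /=.
have := le_lt_trans rt tn; have := le_lt_trans rt tn'; rewrite !ltr_nat.
by split=> -[]; split; lia.
Qed.

Lemma start_first_le_cost K n s q : (1 <= n)%N -> 0 <= K ->
  (q <= size (repls s))%N ->
  start s 1 + q%:R * K <= cost (regular_instance K n) s.
Proof.
move=> n1 K0 qs; rewrite lerD ?ler_wpM2r ?ler_nat//.
have /(flow_time_le_max s) : job (regular_instance K n) 1 by rewrite /job n1.
by rewrite /completion addrK.
Qed.

End RegularInput.

Theorem theorem16 (R : realType) (c : R) (hc : c < 4 / 3) :
  ~ exists A : instance R -> solution R,
      online_algorithm (@regular R) A /\ competitive (@regular R) c A.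
Proof.
move=> [A [[feasA onlineA] compA]].
(* K is chosen so large that the slack [(4 / 3 - c) * K] beats the additive error [4 / 3 * 1] left
   by rounding. *)
have [k Kc] : exists k : nat, 4 / 3 < (4 / 3 - c) * k.+1%:R.
  exists (Num.truncn ((4 / 3 - c)^-1 * (4 / 3))).
  by rewrite -ltr_pdivrMl ?subr_gt0// truncnS_gt.
set K : R := k.+1%:R in Kc.
have K0 : 0 < K by rewrite ltr0n.
(* A late start is too costly once N + K > 4/3 (N/2 + 2K), that is, N > 5K; the factor 8 leaves a
   margin. *)
pose N := (8 * k.+1)%N; pose I := regular_instance K.
have NE : N%:R = 8 * K by rewrite natrM.
have regI n : (1 <= n)%N -> regular (I n).
  by move=> n1; apply: regular_instanceP; rewrite ?ltW.
have optK n : (1 <= n)%N -> K <= opt_cost (I n).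
  by apply: opt_regular_ge; exact: ltW.
have N1 : (1 <= N)%N by [].
have [_ _ /(_ 1%N isT)[t tA /andP[/= t1 tS]]] := feasA _ (regI _ N1).
set S := start (A (I N)) 1 in tS.
have /andP[mS Sm] := truncn_itv (le_trans ler01 (le_trans t1 tS)).
set m := Num.truncn S in mS Sm.
have [mN|Nm] := leqP m.+1 N; last first.
  have opt2 : opt_cost (I N) <= 4 * K + 2 * K.
    rewrite (_ : 4 * K = (uphalf N)%:R); last by rewrite -natrM; congr _%:R; lia.
    by apply: opt_regular_le_double (ltW K0) N1 _; lia.
  have q1 := feasible_has_repl (I := I N) N1 (feasA _ (regI _ N1)).
  have := start_first_le_cost N1 (ltW K0) q1; rewrite -/S -/(I N).
  have NS : N%:R <= S by rewrite (le_trans _ mS)// ler_nat.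
  have := compA _ (regI _ N1); have := optK _ N1.
  by rewrite NE in NS; nra.
(* Needed so that [double m.+1] has two distinct replenishment times. *)
have m1 : (1 <= m)%N.
  by rewrite -ltnS -(ltr_nat R) (le_lt_trans _ Sm)// (le_trans t1).
(* Since S < m + 1 <= N, job m + 1 is still unreleased at time S, so both inputs look alike. *)
have [eq_repls eq_start] :
    same_decisions S (I N) (I m.+1) (A (I N)) (A (I m.+1)).
  apply: onlineA; [exact: regI|exact: regI|].
  by apply: same_information_regular; rewrite (lt_trans Sm)// ltr_nat ltnS// ltnW.
have [_ startE] : job (I m.+1) 1 /\ start (A (I m.+1)) 1 = S.
  by apply/eq_start => //; rewrite lexx.
have tA' : t \in repls (A (I m.+1)).
  have : t \in [seq u <- repls (A (I N)) | u <= S] by rewrite mem_filter tS.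
  by rewrite eq_repls mem_filter => /andP[].
have [_ _ /(_ m.+1)] := feasA _ (regI _ (ltn0Sn m)).
rewrite /job /= leqnn => /(_ isT)[u uA /andP[mu _]].
have q2 : (2 <= size (repls (A (I m.+1))))%N.
  have tu : t != u by rewrite lt_eqF// (le_lt_trans tS)// (lt_le_trans Sm).
  apply: (@uniq_leq_size _ [:: t; u]); first by rewrite /= inE tu.
  by move=> x; rewrite !inE => /orP[] /eqP->.
(* With opt <= 3/4 (m + 2K) + 1 from the two upper bounds, competitiveness gives (4/3 - c) opt <=
   4/3; as opt >= K, this contradicts [Kc]. *)
have := start_first_le_cost (ltn0Sn m) (ltW K0) q2; rewrite startE -/(I m.+1).
have := compA _ (regI _ (ltn0Sn m)); have := optK _ (ltn0Sn m).
have := opt_regular_le_single (ltW K0) (ltn0Sn m); rewrite -/(I m.+1) -natr1.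
have := opt_regular_le_double (ltW K0) (ltn0Sn m) m1; rewrite -/(I m.+1).
have : (uphalf m.+1)%:R * 2 <= m%:R + 2 :> R.
  by rewrite -natrM -natrD ler_nat; lia.
nra.
Qed.
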